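(* Let $\mathcal{A}$ and $\mathcal{B}$ be abelian categories, let $(F,G):\mathcal{A}\to\mathcal{B}$ be an adjoint pair (with $F:\mathcal{A}\to\mathcal{B}$ left adjoint to $G:\mathcal{B}\to\mathcal{A}$), with unit $\eta: 1_{\mathcal{A}}\to GF$ and counit $\varepsilon: FG\to 1_{\mathcal{B}}$, and let $\mathcal{X}\subseteq\mathcal{A}$ and $\mathcal{Y}\subseteq\mathcal{B}$ be subcategories. 1. If $\mathcal{J}\supseteq\mathcal{X}$ is a full subcategory of $\mathcal{A}$ closed under kernels of epimorphisms such that $\eta_M: M\to GF(M)$ is an isomorphism for every $M\in\mathcal{J}$ and $F$ preserves exact sequences in $\mathcal{J}$, then for every $M\in\mathcal{J}$, $$\mathrm{e.l}_{F(\mathcal{X})}\text{-}\dim(F(M))\leq \mathrm{e.l}_{\mathcal{X}}\text{-}\dim(M).$$ 2. If $\mathcal{D}\supseteq\mathcal{Y}$ is a full subcategory of $\mathcal{B}$ closed under cokernels of monomorphisms such that $\varepsilon_N: FG(N)\to N$ is an isomorphism for every $N\in\mathcal{D}$ and $G$ preserves exact sequences in $\mathcal{D}$, then for every $N\in\mathcal{D}$, $$\mathrm{e.r}_{G(\mathcal{Y})}\text{-}\dim(G(N))\leq \mathrm{e.r}_{\mathcal{Y}}\text{-}\dim(N).$$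
   Context: ''Subcategory'' means full subcategory closed under isomorphisms and containing the zero object. For a subcategory $\mathcal{X}$, $F(\mathcal{X})$ denotes the subcategory of objects isomorphic to $F(X)$ with $X\in\mathcal{X}$, and similarly for $G(\mathcal{Y})$. ''$F$ preserves exact sequences in $\mathcal{J}$'' means that $F$ sends every exact sequence of $\mathcal{A}$ all of whose terms lie in $\mathcal{J}$ to an exact sequence of $\mathcal{B}$; similarly for $G$ and $\mathcal{D}$. For a subcategory $\mathcal{F}$ of an abelian category, $\mathrm{e.l}_{\mathcal{F}}\text{-}\dim(M)$ (exact left $\mathcal{F}$-dimension) is the least integer $n\geq 0$ for which there is an exact sequence $0\to A_n\to\cdots\to A_0\to M\to 0$ with all $A_i\in\mathcal{F}$, and $\infty$ if there is none. Dually, $\mathrm{e.r}_{\mathcal{F}}\text{-}\dim(M)$ is the least $n\geq 0$ for which there is an exact sequence $0\to M\to A^0\to\cdots\to A^n\to 0$ with all $A^i\in\mathcal{F}$, and $\infty$ if there is none. *)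

(* Defs.v *)
From HB Require Import structures.
From mathcomp Require Import all_boot all_order all_algebra.
From mathcomp Require Import boolp constructive_ereal.

Set Implicit Arguments.
Unset Strict Implicit.
Unset Printing Implicit Defensive.

Import GRing.Theory.
Local Open Scope ring_scope.

Reserved Notation "g \oc f" (at level 40, left associativity).

(* The choice structure carried by zmodType is no restriction: classically
   (mathcomp.classical.boolp) every abelian group has one. *)
Record preadditive := Preadditive {
  ob :> Type;
  Hom : ob -> ob -> zmodType;
  idm : forall X, Hom X X;
  comp : forall X Y Z, Hom Y Z -> Hom X Y -> Hom X Z;
  compA : forall W X Y Z (h : Hom Y Z) (g : Hom X Y) (f : Hom W X),
    comp h (comp g f) = comp (comp h g) f;
  comp1m : forall X Y (f : Hom X Y), comp (idm Y) f = f;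
  compm1 : forall X Y (f : Hom X Y), comp f (idm X) = f;
  compDl : forall X Y Z (g g' : Hom Y Z) (f : Hom X Y),
    comp (g + g') f = comp g f + comp g' f;
  compDr : forall X Y Z (g : Hom Y Z) (f f' : Hom X Y),
    comp g (f + f') = comp g f + comp g f'
}.

Arguments Hom {_} _ _.
Arguments idm {_} _.
Notation "g \oc f" := (comp g f).

Section Notions.
Variable C : preadditive.
Implicit Types (X Y Z : C).

Definition is_iso X Y (f : Hom X Y) : Prop :=
  exists g : Hom Y X, g \oc f = idm X /\ f \oc g = idm Y.

Definition isomorphic X Y : Prop := exists f : Hom X Y, is_iso f.

Definition mono X Y (f : Hom X Y) : Prop :=
  forall T (u v : Hom T X), f \oc u = f \oc v -> u = v.

Definition epi X Y (f : Hom X Y) : Prop :=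
  forall T (u v : Hom Y T), u \oc f = v \oc f -> u = v.

Definition is_zero Z : Prop :=
  (forall X, exists! f : Hom Z X, True) /\ (forall X, exists! f : Hom X Z, True).

Definition is_kernel K X Y (k : Hom K X) (f : Hom X Y) : Prop :=
  f \oc k = 0 /\
  forall T (t : Hom T X), f \oc t = 0 -> exists! u : Hom T K, k \oc u = t.

Definition is_cokernel X Y Q (q : Hom Y Q) (f : Hom X Y) : Prop :=
  q \oc f = 0 /\
  forall T (t : Hom Y T), t \oc f = 0 -> exists! u : Hom Q T, u \oc q = t.

Definition is_biproduct X Y S (i1 : Hom X S) (i2 : Hom Y S)
    (p1 : Hom S X) (p2 : Hom S Y) : Prop :=
  [/\ p1 \oc i1 = idm X, p2 \oc i2 = idm Y
    & i1 \oc p1 + i2 \oc p2 = idm S].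

Definition is_image I X Y (m : Hom I Y) (f : Hom X Y) : Prop :=
  exists Q (q : Hom Y Q), is_cokernel q f /\ is_kernel m q.

(* Im f = Ker g as subobjects of Y. *)
Definition exact X Y Z (f : Hom X Y) (g : Hom Y Z) : Prop :=
  exists I (m : Hom I Y), is_image m f /\ is_kernel m g.

(* The finite sequence S 0 -> S 1 -> ... -> S m; the terms and maps beyond
   index m are irrelevant. *)
Definition exact_sequence (m : nat) (S : nat -> C)
    (d : forall i, Hom (S i) (S i.+1)) : Prop :=
  forall i, (i.+2 <= m)%N -> exact (d i) (d i.+1).

Definition subcategory (P : C -> Prop) : Prop :=
  (forall Z, is_zero Z -> P Z) /\
  (forall X Y, isomorphic X Y -> P X -> P Y).

Definition subcat_le (P Q : C -> Prop) : Prop := forall X, P X -> Q X.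

Definition closed_under_kernels_of_epis (P : C -> Prop) : Prop :=
  forall K X Y (k : Hom K X) (f : Hom X Y),
    P X -> P Y -> epi f -> is_kernel k f -> P K.

Definition closed_under_cokernels_of_monos (P : C -> Prop) : Prop :=
  forall X Y Q (f : Hom X Y) (q : Hom Y Q),
    P X -> P Y -> mono f -> is_cokernel q f -> P Q.

(* 0 -> A_n -> ... -> A_0 -> M -> 0, with A_i in position n + 1 - i. *)
Definition left_resolution (P : C -> Prop) (M : C) (n : nat) : Prop :=
  exists (S : nat -> C) (d : forall i, Hom (S i) (S i.+1)),
    [/\ is_zero (S 0%N),
        forall i, (1 <= i <= n.+1)%N -> P (S i),
        S n.+2 = M,
        is_zero (S n.+3)
      & exact_sequence n.+3 d].

(* 0 -> M -> A^0 -> ... -> A^n -> 0, with A^i in position i + 2. *)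
Definition right_resolution (P : C -> Prop) (M : C) (n : nat) : Prop :=
  exists (S : nat -> C) (d : forall i, Hom (S i) (S i.+1)),
    [/\ is_zero (S 0%N),
        S 1%N = M,
        forall i, (2 <= i <= n.+2)%N -> P (S i),
        is_zero (S n.+3)
      & exact_sequence n.+3 d].

End Notions.

Record abelian_category := AbelianCategory {
  ab_preadditive :> preadditive;
  ab_zero : exists Z : ab_preadditive, is_zero Z;
  ab_biproduct : forall X Y : ab_preadditive,
    exists S (i1 : Hom X S) (i2 : Hom Y S) (p1 : Hom S X) (p2 : Hom S Y),
      is_biproduct i1 i2 p1 p2;
  ab_kernel : forall (X Y : ab_preadditive) (f : Hom X Y),
    exists K (k : Hom K X), is_kernel k f;
  ab_cokernel : forall (X Y : ab_preadditive) (f : Hom X Y),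
    exists Q (q : Hom Y Q), is_cokernel q f;
  ab_mono : forall (X Y : ab_preadditive) (f : Hom X Y), mono f ->
    exists Z (g : Hom Y Z), is_kernel f g;
  ab_epi : forall (X Y : ab_preadditive) (f : Hom X Y), epi f ->
    exists W (g : Hom W X), is_cokernel f g
}.

(* The least n satisfying P, and +oo if there is none. *)
Definition least (P : nat -> Prop) : \bar int :=
  match pselect (exists n, `[< P n >]) with
  | left exP => (Posz (ex_minn exP))%:E
  | right _ => +oo%E
  end.

Definition el_dim (C : preadditive) (P : C -> Prop) (M : C) : \bar int :=
  least (left_resolution P M).

Definition er_dim (C : preadditive) (P : C -> Prop) (M : C) : \bar int :=
  least (right_resolution P M).

(* Additivity is not required: it is automatic for adjoint functors between
   abelian categories. *)
Record functor (C D : preadditive) := Functor {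
  fobj :> C -> D;
  fmap : forall X Y : C, Hom X Y -> Hom (fobj X) (fobj Y);
  fmap_id : forall X : C, fmap (idm X) = idm (fobj X);
  fmap_comp : forall (X Y Z : C) (g : Hom Y Z) (f : Hom X Y),
    fmap (g \oc f) = fmap g \oc fmap f
}.

Arguments fmap {C D} _ {X Y} _.

(* F is left adjoint to G. *)
Record adjunction (C D : preadditive) (F : functor C D) (G : functor D C) :=
  Adjunction {
  unit_adj : forall X : C, Hom X (G (F X));
  counit_adj : forall Y : D, Hom (F (G Y)) Y;
  unit_adj_nat : forall (X X' : C) (f : Hom X X'),
    fmap G (fmap F f) \oc unit_adj X = unit_adj X' \oc f;
  counit_adj_nat : forall (Y Y' : D) (g : Hom Y Y'),
    counit_adj Y' \oc fmap F (fmap G g) = g \oc counit_adj Y;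
  triangle_left : forall X : C,
    counit_adj (F X) \oc fmap F (unit_adj X) = idm (F X);
  triangle_right : forall Y : D,
    fmap G (counit_adj Y) \oc unit_adj (G Y) = idm (G Y)
}.

Definition fimage (C D : preadditive) (F : functor C D) (P : C -> Prop) :
    D -> Prop :=
  fun Y => exists X, P X /\ isomorphic (F X) Y.

Definition preserves_exact_sequences_in (C D : preadditive)
    (F : functor C D) (P : C -> Prop) : Prop :=
  forall (m : nat) (S : nat -> C) (d : forall i, Hom (S i) (S i.+1)),
    (forall i, (i <= m)%N -> P (S i)) ->
    exact_sequence m d ->
    exact_sequence m (fun i => fmap F (d i)).

(* Main.v *)
Require Import Defs.
From mathcomp Require Import all_boot all_order all_algebra.
From mathcomp Require Import boolp constructive_ereal.

(** A resolution of an object of [J] by objects of [X] has all its terms in [J],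
    so [F] maps it to an exact sequence; being a left adjoint, [F] sends zero
    objects to zero objects, and the image is a resolution of the same length. *)

(* [all_algebra] shadows [Hom]. *)
Import Defs.
Import GRing.Theory.

Set Implicit Arguments.
Unset Strict Implicit.

Lemma comp0m (C : preadditive) (X Y Z : C) (f : Hom X Y) :
  (0%R : Hom Y Z) \oc f = 0%R.
Proof.
by apply: (addrI (comp 0%R f)); rewrite -compDl !addr0.
Qed.

Lemma compm0 (C : preadditive) (X Y Z : C) (g : Hom Y Z) :
  g \oc (0%R : Hom X Y) = 0%R.
Proof.
by apply: (addrI (comp g 0%R)); rewrite -compDr !addr0.
Qed.

(** Every morphism into or out of [Z] factors through [idm Z], so it vanishes with it. *)
Lemma is_zero_idm0 (C : preadditive) (Z : C) : idm Z = 0%R -> is_zero Z.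
Proof.
move=> id0; split=> X; exists 0%R; split=> // f _.
  by rewrite -[f]compm1 id0 compm0.
by rewrite -[f]comp1m id0 comp0m.
Qed.

Section AdjointZero.
Variables (C D : preadditive) (F : functor C D) (G : functor D C).
Variable adj : adjunction F G.

(** The transpose [h |-> fmap G h \oc unit_adj adj X] has a retraction,
    [u |-> counit_adj adj Y \oc fmap F u], by naturality of the counit and the first triangle
    identity. *)
Lemma transpose_left_inj (X : C) (Y : D) (f g : Hom (F X) Y) :
  fmap G f \oc unit_adj adj X = fmap G g \oc unit_adj adj X -> f = g.
Proof.
have K (h : Hom (F X) Y) :
    counit_adj adj Y \oc fmap F (fmap G h \oc unit_adj adj X) = h.
  by rewrite fmap_comp compA counit_adj_nat -compA triangle_left compm1.
by move=> fg; rewrite -[f]K fg K.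
Qed.

Lemma transpose_right_inj (X : C) (Y : D) (f g : Hom X (G Y)) :
  counit_adj adj Y \oc fmap F f = counit_adj adj Y \oc fmap F g -> f = g.
Proof.
have K (h : Hom X (G Y)) :
    fmap G (counit_adj adj Y \oc fmap F h) \oc unit_adj adj X = h.
  by rewrite fmap_comp -compA unit_adj_nat compA triangle_right comp1m.
by move=> fg; rewrite -[f]K fg K.
Qed.

(** No additivity of [F] or [G] enters: the transposes of [idm (F Z)] and of [0] are both morphisms
    out of the initial object [Z], hence equal, which forces [idm (F Z) = 0]. *)
Lemma left_adjoint_is_zero (Z : C) : is_zero Z -> is_zero (F Z).
Proof.
move=> [initZ _]; apply/is_zero_idm0/transpose_left_inj.
have [h [_ hE]] := initZ (G (F Z)).
by transitivity h; [symmetry|]; apply: hE.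
Qed.

Lemma right_adjoint_is_zero (Z : D) : is_zero Z -> is_zero (G Z).
Proof.
move=> [_ termZ]; apply/is_zero_idm0/transpose_right_inj.
(* Dually, the two transposes now end at [Z], which is terminal. *)
have [h [_ hE]] := termZ (F (G Z)).
by transitivity h; [symmetry|]; apply: hE.
Qed.

End AdjointZero.

Lemma isomorphic_refl (C : preadditive) (X : C) : isomorphic X X.
Proof. by exists (idm X), (idm X); rewrite comp1m. Qed.

Lemma fimage_obj (C D : preadditive) (F : functor C D) (P : C -> Prop) (X : C) :
  P X -> fimage F P (F X).
Proof. by move=> PX; exists X; split=> //; apply: isomorphic_refl. Qed.

Lemma le_least (P Q : nat -> Prop) :
  (forall n, P n -> Q n) -> (least Q <= least P)%E.
Proof.
move=> PQ; rewrite /least.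
case: (pselect (exists n, `[< P n >])) => [exP|_]; last exact: leey.
(* With no witness for [P] the bound was [+oo]; a witness for [P] is one for [Q], so here both sides
   are finite. *)
case: pselect => [exQ|[]]; last first.
  by case: exP => n /asboolP /PQ Qn; exists n; apply/asboolP.
rewrite lee_fin lez_nat.
case: ex_minnP => q _ qmin; case: ex_minnP => p /asboolP Pp _.
exact/qmin/asboolP/PQ.
Qed.

Section Resolutions.
Variables (C D : preadditive) (F : functor C D) (P J : C -> Prop).
Hypothesis F0 : forall Z : C, is_zero Z -> is_zero (F Z).
Hypothesis J0 : forall Z : C, is_zero Z -> J Z.
Hypothesis PJ : subcat_le P J.
Hypothesis exF : preserves_exact_sequences_in F J.

Lemma fmap_left_resolution (M : C) (n : nat) :
  J M -> left_resolution P M n -> left_resolution (fimage F P) (F M) n.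
Proof.
move=> JM [S [d [S0 PS SM Sz exS]]].
exists (fun i => F (S i)), (fun i => fmap F (d i)); split.
- exact: F0.
- by move=> i /PS; apply: fimage_obj.
- by rewrite SM.
- exact: F0.
(* All terms lie in [J]: positions [n.+3] and [0] hold zero objects, position [n.+2] holds [M], and
   positions [1] to [n.+1] hold objects of [P]. *)
apply: exF exS => i; rewrite leq_eqVlt => /predU1P[->|]; first exact: J0.
rewrite ltnS leq_eqVlt => /predU1P[->|]; first by rewrite SM.
rewrite ltnS; case: i => [_|i lein]; first exact: J0.
exact/PJ/PS.
Qed.

Lemma fmap_right_resolution (M : C) (n : nat) :
  J M -> right_resolution P M n -> right_resolution (fimage F P) (F M) n.
Proof.
move=> JM [S [d [S0 SM PS Sz exS]]].
exists (fun i => F (S i)), (fun i => fmap F (d i)); split.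
- exact: F0.
- by rewrite SM.
- by move=> i /PS; apply: fimage_obj.
- exact: F0.
(* Here [M] sits in position [1], and the objects of [P] in positions [2] to [n.+2]. *)
apply: exF exS => i; rewrite leq_eqVlt => /predU1P[->|]; first exact: J0.
rewrite ltnS; case: i => [|[|i]] lein; first exact: J0.
  by rewrite SM.
exact/PJ/PS.
Qed.

End Resolutions.

Theorem theorem3p4 (A B : abelian_category) (F : functor A B) (G : functor B A)
    (adj : adjunction F G) (X : A -> Prop) (Y : B -> Prop)
    (hX : subcategory X) (hY : subcategory Y) :
  (forall J : A -> Prop,
      subcategory J -> subcat_le X J ->
      closed_under_kernels_of_epis J ->
      (forall M : A, J M -> is_iso (unit_adj adj M)) ->
      preserves_exact_sequences_in F J ->
      forall M : A, J M ->
        (el_dim (fimage F X) (F M) <= el_dim X M)%E)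
  /\
  (forall D : B -> Prop,
      subcategory D -> subcat_le Y D ->
      closed_under_cokernels_of_monos D ->
      (forall N : B, D N -> is_iso (counit_adj adj N)) ->
      preserves_exact_sequences_in G D ->
      forall N : B, D N ->
        (er_dim (fimage G Y) (G N) <= er_dim Y N)%E).
Proof.
split=> [J [J0 _] XJ _ _ exF M JM | D [D0 _] YD _ _ exG N DN].
  (* It suffices to transport resolutions of each fixed length [n]. *)
  apply: le_least => n; apply: fmap_left_resolution XJ exF _ _ JM => //.
  exact: left_adjoint_is_zero adj.
apply: le_least => n; apply: fmap_right_resolution YD exG _ _ DN => //.
exact: right_adjoint_is_zero adj.
Qed.
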